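(* Let $\lambda\in\mathbb{R}$, and on $\mathbb{R}_{>0}^2$ with coordinates $(x,y)$ let $$h_\lambda=\begin{pmatrix}a&b\\ b&d\end{pmatrix},\qquad a=\frac{1+\lambda y}{x^3},\quad b=-\lambda\frac{x^2+y^2}{2x^2y^2},\quad d=\frac{1+\lambda x}{y^3},$$ and $$\tilde g=\frac{x^2+y^2}{2xy}\begin{pmatrix}x^{-2}&-\frac1{xy}\\ -\frac1{xy}&y^{-2}\end{pmatrix}.$$ If $\det(h_\lambda)=ad-b^2\neq0$, then the $(1,1)$-tensor $A_\lambda=h_\lambda^{-1}\tilde g$ is given by $$A_\lambda=\frac{x^2+y^2}{2xy}\,\frac1{ad-b^2}\begin{pmatrix}\dfrac{d}{x^2}+\dfrac{b}{xy}&-\dfrac{d}{xy}-\dfrac{b}{y^2}\\[8pt]-\dfrac{b}{x^2}-\dfrac{a}{xy}&\dfrac{b}{xy}+\dfrac{a}{y^2}\end{pmatrix}.$$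
   Context: All matrices are taken with respect to the coordinate frame $(\partial_x,\partial_y)$. With $J(s)=\frac12(s+s^{-1})-1$, the matrix $h_\lambda$ is the Hessian in $(x,y)$ of $\Phi_\lambda(x,y)=J(x)+J(y)+\lambda J(x/y)$, and $\tilde g=\cosh(\log(x/y))\,\omega\otimes\omega$ with $\omega=\frac{dx}{x}-\frac{dy}{y}$. The tensor $A_\lambda=h_\lambda^{-1}\tilde g$ is defined by $h_\lambda(A_\lambda X,Y)=\tilde g(X,Y)$ for all $X,Y$. *)

(* Defs.v *)
From mathcomp Require Import all_boot all_order all_algebra.
From mathcomp Require Import all_classical all_reals all_analysis.

Set Implicit Arguments.
Unset Strict Implicit.
Unset Printing Implicit Defensive.

Import Order.TTheory GRing.Theory Num.Theory.
Import numFieldNormedType.Exports.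

Local Open Scope ring_scope.

(* Points of the positive quadrant are given by their coordinates x, y.
   Tangent vectors are columns and covectors are rows of coordinates in the
   frame (d/dx, d/dy) and its dual (dx, dy); index 0 is x and index 1 is y. *)

Definition mx2 (R : realType) (a b c d : R) : 'M[R]_2 :=
  \matrix_(i < 2, j < 2)
    if i == 0 then (if j == 0 then a else b) else (if j == 0 then c else d).

Definition partial_x (R : realType) (f : R -> R -> R) : R -> R -> R :=
  fun x y => (fun t => f t y)^`()%classic x.

Definition partial_y (R : realType) (f : R -> R -> R) : R -> R -> R :=
  fun x y => (fun t => f x t)^`()%classic y.

Definition hessian (R : realType) (f : R -> R -> R) (x y : R) : 'M[R]_2 :=
  mx2 (partial_x (partial_x f) x y) (partial_x (partial_y f) x y)
      (partial_y (partial_x f) x y) (partial_y (partial_y f) x y).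

Definition J (R : realType) (s : R) : R := 2^-1 * (s + s^-1) - 1.

Definition Phi (R : realType) (lambda x y : R) : R :=
  J x + J y + lambda * J (x / y).

Definition h (R : realType) (lambda x y : R) : 'M[R]_2 :=
  hessian (Phi lambda) x y.

Definition cosh (R : realType) (t : R) : R := 2^-1 * (expR t + expR (- t)).

Definition dx (R : realType) : 'rV[R]_2 := delta_mx 0 0.
Definition dy (R : realType) : 'rV[R]_2 := delta_mx 0 1.

Definition omega (R : realType) (x y : R) : 'rV[R]_2 :=
  x^-1 *: dx R - y^-1 *: dy R.

(* Matrix of the (0,2)-tensor alpha (x) beta, (X, Y) |-> alpha(X) beta(Y). *)
Definition tensor (R : realType) (alpha beta : 'rV[R]_2) : 'M[R]_2 :=
  alpha^T *m beta.

Definition gtilde (R : realType) (x y : R) : 'M[R]_2 :=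
  cosh (ln (x / y)) *: tensor (omega x y) (omega x y).

Definition bilin (R : realType) (B : 'M[R]_2) (X Y : 'cV[R]_2) : R :=
  (X^T *m B *m Y) 0 0.

(* A is the value at (x, y) of the (1,1)-tensor A_lambda; it acts on tangent
   vectors by X |-> A *m X. *)
Definition is_Alambda (R : realType) (lambda x y : R) (A : 'M[R]_2) : Prop :=
  forall X Y : 'cV[R]_2,
    bilin (h lambda x y) (A *m X) Y = bilin (gtilde x y) X Y.

(* Main.v *)
Require Import Defs.
From mathcomp Require Import all_boot all_order all_algebra.
From mathcomp Require Import all_classical all_reals all_analysis.
From mathcomp Require Import ring.

Import Order.TTheory GRing.Theory Num.Theory.
Import numFieldNormedType.Exports.
Local Open Scope ring_scope.

(** As a function of one variable s, with the other one fixed, Phi_lambda and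
    its first partial derivatives are Laurent polynomials with exponents between
    -2 and 1, so every differentiation is an instance of one formula,
    [derive1_laurent].  As J is invariant under s |-> s^-1, Phi_lambda is
    symmetric in (x, y) ([PhiC]); hence every y-derivative is an x-derivative
    with the coordinates exchanged, and only the entries xx and xy of the
    Hessian have to be computed.

    For the metric, cosh o ln is the rational function (s + s^-1) / 2 on
    positive reals ([cosh_ln]), while omega (x) omega is a rank-one product.

    Finally, h (A X, Y) = g (X, Y) for all X, Y is the matrix equation
    A^T h = g ([bilin_eqP]).  As h and g are symmetric this says h A = g, whose
    only solution for invertible h is h^-1 g; its entries follow from Cramer's
    formula for a 2 x 2 inverse ([invmx_mx2]). *)

(** * Matrices of size two *)

Lemma mx2P (R : realType) (A B : 'M[R]_2) :
  A 0 0 = B 0 0 -> A 0 1 = B 0 1 -> A 1 0 = B 1 0 -> A 1 1 = B 1 1 -> A = B.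
Proof.
move=> e00 e01 e10 e11; apply/matrixP.
have ord2 (i : 'I_2) : i = 0 \/ i = 1.
  by case: i => -[|[|//]] lt_i; [left | right]; apply/val_inj.
by move=> i j; case: (ord2 i) => ->; case: (ord2 j) => ->.
Qed.

Lemma mulmx2 (R : realType) (a b c d a' b' c' d' : R) :
  mx2 a b c d *m mx2 a' b' c' d' =
  mx2 (a * a' + b * c') (a * b' + b * d') (c * a' + d * c') (c * b' + d * d').
Proof. by apply: mx2P; rewrite !mxE !big_ord_recl big_ord0 !mxE /= addr0. Qed.

Lemma scalemx2 (R : realType) (k a b c d : R) :
  k *: mx2 a b c d = mx2 (k * a) (k * b) (k * c) (k * d).
Proof. by apply: mx2P; rewrite !mxE. Qed.

Lemma trmx_mx2 (R : realType) (a b c d : R) : (mx2 a b c d)^T = mx2 a c b d.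
Proof. by apply: mx2P; rewrite !mxE. Qed.

Lemma det_mx2 (R : realType) (a b c d : R) :
  \det (mx2 a b c d) = a * d - b * c.
Proof.
rewrite (expand_det_row _ 0) !big_ord_recl big_ord0 /cofactor !det_mx11 !mxE /=.
ring.
Qed.

Lemma invmx_mx2 (R : realType) (a b c d : R) : a * d - b * c != 0 ->
  invmx (mx2 a b c d) = (a * d - b * c)^-1 *: mx2 d (- b) (- c) a.
Proof.
move=> D0; have U : mx2 a b c d \in unitmx by rewrite unitmxE det_mx2 unitfE.
apply: (can_inj (mulKmx U)); rewrite mulmxV // -scalemxAr mulmx2 scalemx2.
by apply: mx2P; rewrite !mxE /=; field.
Qed.

Lemma bilin_inj (R : realType) (B C : 'M[R]_2) :
  (forall X Y, bilin B X Y = bilin C X Y) -> B = C.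
Proof.
move=> eqBC; apply/matrixP => i j.
have bilin_delta (D : 'M[R]_2) : bilin D (delta_mx i 0) (delta_mx j 0) = D i j.
  by rewrite /bilin trmx_delta -rowE -colE !mxE.
by rewrite -!bilin_delta.
Qed.

(** The defining condition of a (1,1)-tensor by lowering an index, as a matrix
    equation; the transpose appears because A acts on the first argument. *)
Lemma bilin_eqP (R : realType) (H G A : 'M[R]_2) :
  (forall X Y, bilin H (A *m X) Y = bilin G X Y) <-> A^T *m H = G.
Proof.
have bilinM X Y : bilin H (A *m X) Y = bilin (A^T *m H) X Y.
  by rewrite /bilin trmx_mul !mulmxA.
split=> [eqG | <- //]; apply: bilin_inj => X Y; by rewrite -bilinM.
Qed.

(** * The Hessian of Phi *)

Lemma derive1_laurent (R : realType) (q r p w t : R) : 0 < t ->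
  (fun s => q * s + r + p * s^-1 + w * s ^- 2)^`()%classic t =
  q - p * t ^- 2 - 2 * w * t ^- 3.
Proof.
move=> t0; have tn0 : t != 0 by rewrite gt_eqF.
have dV : is_derive t 1 (fun s : R => s^-1) (- t ^- 2).
  by apply: is_derive_eq (is_deriveV tn0 (is_derive_id t 1)) _; exact: mulr1.
have -> : (fun s => q * s + r + p * s^-1 + w * s ^- 2) =
    q *: id + cst r + p *: (fun s => s^-1) + w *: (fun s => s^-1) ^+ 2.
  by apply/funext => s; rewrite !fctE exprVn.
rewrite derive1E; apply: derive_val.
by apply: is_derive_eq; rewrite /= /GRing.scale /=; field.
Qed.

Lemma JV (R : realType) (s : R) : J s^-1 = J s.
Proof. by rewrite /J invrK [s^-1 + _]addrC. Qed.

Lemma PhiC (R : realType) (lambda x y : R) : Phi lambda x y = Phi lambda y x.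
Proof. by rewrite /Phi -[J (x / y)]JV invf_div [J x + _]addrC. Qed.

Lemma partial_yC (R : realType) (f g : R -> R -> R) :
  (forall x y, f x y = g y x) ->
  forall x y, partial_y f x y = partial_x g y x.
Proof.
move=> fg x y; rewrite /partial_y /partial_x; congr (derive1 _ _).
exact/funext.
Qed.

Lemma partial_x_Phi (R : realType) (lambda x y : R) : 0 < x ->
  partial_x (Phi lambda) x y =
  2^-1 * (1 + lambda * y^-1) - 2^-1 * (1 + lambda * y) * x ^- 2.
Proof.
move=> x0; rewrite /partial_x.
rewrite (_ : (fun t => _) = fun s => 2^-1 * (1 + lambda * y^-1) * s +
    (J y - 1 - lambda) + 2^-1 * (1 + lambda * y) * s^-1 + 0 * s ^- 2).
  by rewrite derive1_laurent // mulr0 mul0r subr0.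
apply/funext => s; rewrite /Phi /J invf_div; ring.
Qed.

(** The formula for an inner derivative holds only on the positive half-line;
    as this is a neighbourhood of x, the outer derivative may still use it. *)
Lemma partial_x_near (R : realType) (f g : R -> R -> R) (x y : R) : 0 < x ->
  (forall t, 0 < t -> f t y = g t y) -> partial_x f x y = partial_x g x y.
Proof.
move=> x0 fg; rewrite /partial_x !derive1E; apply: near_eq_derive.
by near=> t; apply: fg; near: t; exact: lt_nbhsr.
Unshelve. all: by end_near. Qed.

Lemma partial_xx_Phi (R : realType) (lambda x y : R) : 0 < x ->
  partial_x (partial_x (Phi lambda)) x y = (1 + lambda * y) / x ^+ 3.
Proof.
move=> x0; pose f (s _ : R) : R := 0 * s + 2^-1 * (1 + lambda * y^-1) + 0 * s^-1
  + (- (2^-1 * (1 + lambda * y))) * s ^- 2.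
rewrite (@partial_x_near _ _ f) //; last first.
  by move=> t t0; rewrite partial_x_Phi // /f; ring.
rewrite /partial_x derive1_laurent //; field.
by rewrite gt_eqF.
Qed.

Lemma partial_xy_Phi (R : realType) (lambda x y : R) : 0 < x -> 0 < y ->
  partial_x (partial_y (Phi lambda)) x y =
  - lambda * ((x ^+ 2 + y ^+ 2) / (2 * x ^+ 2 * y ^+ 2)).
Proof.
move=> x0 y0; pose f (s _ : R) : R := (- (2^-1 * lambda * y ^- 2)) * s +
  2^-1 * (1 - y ^- 2) + (2^-1 * lambda) * s^-1 + 0 * s ^- 2.
rewrite (@partial_x_near _ _ f) //; last first.
  by move=> t t0; rewrite (partial_yC _ _ _ (PhiC _ lambda)) partial_x_Phi // /f; ring.
rewrite /partial_x derive1_laurent //; field.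
by rewrite !gt_eqF.
Qed.

Lemma hE (R : realType) (lambda x y : R) : 0 < x -> 0 < y ->
  let b := - lambda * ((x ^+ 2 + y ^+ 2) / (2 * x ^+ 2 * y ^+ 2)) in
  h lambda x y =
  mx2 ((1 + lambda * y) / x ^+ 3) b b ((1 + lambda * x) / y ^+ 3).
Proof.
move=> x0 y0 b; have dyE := partial_yC _ _ _ (PhiC _ lambda).
have dxE u v : partial_x (Phi lambda) u v = partial_y (Phi lambda) v u.
  by rewrite dyE.
rewrite /h /hessian (partial_yC _ _ _ dxE) (partial_yC _ _ _ dyE).
rewrite !partial_xx_Phi // !partial_xy_Phi //; congr mx2.
by rewrite /b [y ^+ 2 + _]addrC; congr (_ * (_ / _)); ring.
Qed.

(** * The metric *)

Lemma cosh_ln (R : realType) (s : R) : 0 < s -> cosh (ln s) = 2^-1 * (s + s^-1).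
Proof. by move=> s0; rewrite /cosh expRN lnK. Qed.

Lemma gtildeE (R : realType) (x y : R) : 0 < x -> 0 < y ->
  gtilde x y = ((x ^+ 2 + y ^+ 2) / (2 * x * y)) *:
    mx2 (x ^- 2) (- (x * y)^-1) (- (x * y)^-1) (y ^- 2).
Proof.
move=> x0 y0; have xn0 : x != 0 by rewrite gt_eqF.
have yn0 : y != 0 by rewrite gt_eqF.
rewrite /gtilde cosh_ln ?divr_gt0 // invf_div; congr (_ *: _).
  by field; rewrite xn0 yn0.
by apply: mx2P; rewrite !mxE big_ord_recl big_ord0 !mxE /=; field;
  rewrite ?xn0 ?yn0.
Qed.

(** * The tensor A *)

Theorem proposition5p1 (R : realType) (lambda x y : R)
    (x_gt0 : 0 < x) (y_gt0 : 0 < y) :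
  let a := (1 + lambda * y) / x ^+ 3 in
  let b := - lambda * ((x ^+ 2 + y ^+ 2) / (2 * x ^+ 2 * y ^+ 2)) in
  let d := (1 + lambda * x) / y ^+ 3 in
  let c := (x ^+ 2 + y ^+ 2) / (2 * x * y) in
  let A0 := (c * (a * d - b ^+ 2)^-1) *:
    mx2 (d / x ^+ 2 + b / (x * y)) (- (d / (x * y)) - b / y ^+ 2)
        (- (b / x ^+ 2) - a / (x * y)) (b / (x * y) + a / y ^+ 2) in
  [/\ h lambda x y = mx2 a b b d,
      gtilde x y = c *: mx2 (x ^- 2) (- (x * y)^-1) (- (x * y)^-1) (y ^- 2),
      \det (h lambda x y) = a * d - b ^+ 2 &
      \det (h lambda x y) != 0 ->
        invmx (h lambda x y) *m gtilde x y = A0 /\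
        (forall A : 'M[R]_2, is_Alambda lambda x y A <-> A = A0)].
Proof.
move=> a b d c A0.
have hab : h lambda x y = mx2 a b b d by exact: hE.
have gab := gtildeE _ _ _ x_gt0 y_gt0.
have detE : \det (h lambda x y) = a * d - b ^+ 2 by rewrite hab det_mx2 expr2.
split=> // det_neq0; set H := h lambda x y in hab detE det_neq0 *.
have HA0 : invmx H *m gtilde x y = A0.
  rewrite hab invmx_mx2 -?expr2 -?detE // detE gab -scalemxAl -scalemxAr scalerA.
  rewrite mulmx2 /A0 [_ * c]mulrC -/c; congr (_ *: mx2 _ _ _ _); ring.
have HU : H \in unitmx by rewrite unitmxE unitfE.
have Hsym : H^T = H by rewrite hab trmx_mx2.
have gsym : (gtilde x y)^T = gtilde x y by rewrite gab linearZ /= trmx_mx2.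
split=> // A; rewrite -HA0 /is_Alambda bilin_eqP -/H.
split=> [AHg | ->]; last by rewrite trmx_mul gsym trmx_inv Hsym mulmxKV.
by rewrite -gsym -AHg trmx_mul trmxK Hsym mulKmx.
Qed.
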